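(* Let $L$ be a finite dimensional complex Leibniz algebra, let $\Im$ be a Cartan subalgebra of $L$, let $I$ be the ideal of $L$ generated by all squares $[x,x]$, $x\in L$, and let $\varphi:L\to L/I$ be the natural homomorphism. Then the image $\varphi(\Im)$ is a Cartan subalgebra of the Lie algebra $L/I$.
   Context: A Leibniz algebra over a field $F$ is an $F$-vector space $L$ with a bilinear multiplication $[\cdot,\cdot]$ satisfying $[x,[y,z]]=[[x,y],z]-[[x,z],y]$ for all $x,y,z\in L$. Lie algebras are Leibniz algebras, and the quotient of $L$ by the (two-sided) ideal $I=\mathrm{ideal}\langle [x,x] : x\in L\rangle$ is a Lie algebra. For an algebra $A$ put $A^1=A$, $A^{n+1}=[A^n,A^1]$; $A$ is nilpotent if $A^s=0$ for some $s\in\mathbb{N}$. A subalgebra $\Im$ of a Leibniz algebra $L$ is called a Cartan subalgebra if (a) $\Im$ is nilpotent, and (b) $\Im$ coincides with its left normalizator $l(\Im)=\{x\in L : [x,\Im]\subseteq\Im\}$. For Lie algebras this agrees with the usual definition of a Cartan subalgebra. *)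

(* Defs.v *)
From HB Require Import structures.
From mathcomp Require Import all_boot all_order all_algebra.
From mathcomp Require Export boolp classical_sets reals.
From mathcomp Require Export complex.

Set Implicit Arguments.
Unset Strict Implicit.
Unset Printing Implicit Defensive.

Import GRing.Theory.

Local Open Scope ring_scope.
Local Open Scope quotient_scope.
Local Open Scope classical_set_scope.

HB.mixin Record Vector_isLeibniz (F : fieldType) L of Vector F L := {
  bracket : L -> L -> L;
  bracket_bilinear_subproof : bilinear_for *:%R *:%R bracket;
  bracket_leibniz : forall x y z,
    bracket x (bracket y z) = bracket (bracket x y) z - bracket (bracket x z) y
}.

#[short(type="leibnizAlgType")]
HB.structure Definition LeibnizAlg (F : fieldType) :=
  {L of Vector_isLeibniz F L & Vector F L}.

(* For an alternating bracket the Leibniz identity is the Jacobi identity. *)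
HB.mixin Record Leibniz_isLie (F : fieldType) L of LeibnizAlg F L := {
  bracketxx : forall x : L, bracket x x = 0
}.

#[short(type="lieAlgType")]
HB.structure Definition LieAlg (F : fieldType) :=
  {L of Leibniz_isLie F L & LeibnizAlg F L}.

HB.instance Definition _ (F : fieldType) (L : leibnizAlgType F) :=
  bilinear_isBilinear.Build F L L L *:%R *:%R (@bracket F L)
    (@bracket_bilinear_subproof F L).

Section Subspaces.
Variables (F : fieldType) (L : leibnizAlgType F).
Implicit Types (U V W H : {vspace L}) (x y : L).

Definition bracketv U V : {vspace L} :=
  <<[seq bracket u v | u <- vbasis U, v <- vbasis V]>>%VS.

Lemma memv_bracket U V x y :
  x \in U -> y \in V -> bracket x y \in bracketv U V.
Proof.
move=> /coord_vbasis-> /coord_vbasis->.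
rewrite linear_sumlz; apply: memv_suml => i _.
rewrite linear_sumr; apply: memv_suml => j _.
rewrite linearZl_LR linearZr_LR; do 2!apply: memvZ.
by apply/memv_span/allpairs_f; apply: mem_nth; rewrite size_tuple.
Qed.

Lemma bracketvP U V W :
  reflect (forall x y, x \in U -> y \in V -> bracket x y \in W)
          (bracketv U V <= W)%VS.
Proof.
apply: (iffP idP) => [sW x y xU yV|sW].
  by apply: (subvP sW); apply: memv_bracket.
apply/span_subvP => _ /allpairsP[[x y] /= [xU yV ->]].
by apply: sW; apply: vbasis_mem.
Qed.

Definition is_subalgebra H := (bracketv H H <= H)%VS.

(* Indexing is shifted by one: [lower_central H n] is H^(n+1). *)
Fixpoint lower_central H n : {vspace L} :=
  if n is m.+1 then bracketv (lower_central H m) H else H.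

Definition is_nilpotent H := exists n, lower_central H n = 0%VS.

Definition left_normalizer H : set L :=
  [set x | forall h, h \in H -> bracket x h \in H].

Definition is_cartan H :=
  [/\ is_subalgebra H, is_nilpotent H
    & [set x | x \in H] = left_normalizer H].

Definition is_ideal U :=
  forall x u, u \in U -> bracket x u \in U /\ bracket u x \in U.

Record ideal := Ideal {
  ideal_space :> {vspace L};
  idealP : is_ideal ideal_space
}.

Lemma ideal_gen_exists (S : set L) :
  exists I : ideal, (forall x, S x -> x \in ideal_space I) /\
    forall J : ideal, (forall x, S x -> x \in ideal_space J) ->
      (ideal_space I <= ideal_space J)%VS.
Proof.
pose P n := exists I : ideal,
  (forall x, S x -> x \in ideal_space I) /\ \dim I = n.
have full_ideal : is_ideal fullv by move=> x u _; rewrite !memvf.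
have exP : exists n, `[< P n >].
  exists (\dim (fullv : {vspace L})); apply/asboolP.
  by exists (Ideal full_ideal); split=> // x _; rewrite memvf.
have /asboolP[I [SI dI]] := xchooseP exP.
case: (ex_minnP exP) => n /asboolP[{SI dI}I [SI dI]] min_n.
exists I; split=> // J SJ.
have IJ_ideal : is_ideal (I :&: J)%VS.
  move=> x u; rewrite memv_cap => /andP[uI uJ].
  have [xu ux] := idealP (i := I) x uI; have [xu' ux'] := idealP (i := J) x uJ.
  by rewrite !memv_cap xu xu' ux ux'.
have le_n : (n <= \dim (I :&: J))%N.
  apply: min_n; apply/asboolP; exists (Ideal IJ_ideal); split=> // x Sx.
  by rewrite memv_cap SI ?SJ.
have /eqP eqI : (I :&: J == I :> {vspace L})%VS.
  by rewrite eqEdim capvSl dI.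
by rewrite -eqI capvSr.
Qed.

Definition ideal_gen (S : set L) : ideal := projT1 (cid (ideal_gen_exists S)).

Lemma sub_ideal_gen (S : set L) x : S x -> x \in ideal_space (ideal_gen S).
Proof. by move: x; exact: (projT2 (cid (ideal_gen_exists S))).1. Qed.

Lemma ideal_gen_min (S : set L) (J : ideal) :
  (forall x, S x -> x \in ideal_space J) ->
  (ideal_space (ideal_gen S) <= ideal_space J)%VS.
Proof. exact: (projT2 (cid (ideal_gen_exists S))).2. Qed.

Definition squares_ideal : ideal := ideal_gen [set bracket x x | x in [set: L]].

End Subspaces.

Arguments ideal {F} L.
Arguments squares_ideal {F} L.

Section Quotient.
Variables (F : fieldType) (L : leibnizAlgType F) (I : ideal L).

Definition quot_alg := Quotient.quot (pred_of_vspace I).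
Local Notation Q := quot_alg.

HB.instance Definition _ := GRing.Zmodule.on Q.
HB.instance Definition _ := ZmodQuotient.on Q.

Definition quot_proj (x : L) : Q := \pi_Q x.
Local Notation proj := quot_proj.

Lemma quot_ind (P : Q -> Prop) : (forall x, P (proj x)) -> forall q, P q.
Proof. exact: quotW. Qed.

Lemma quot_eqE (x y : L) : (proj x == proj y) = (x - y \in ideal_space I).
Proof. by rewrite /quot_proj (Quotient.idealrBE (pred_of_vspace I)). Qed.

Lemma quot_eqP (x y : L) :
  reflect (proj x = proj y) (x - y \in ideal_space I).
Proof. by rewrite -quot_eqE; apply: eqP. Qed.

Lemma quot_reprB (x : L) : repr (proj x) - x \in ideal_space I.
Proof. by apply/quot_eqP; rewrite /quot_proj reprK. Qed.

Lemma projD (x y : L) : proj (x + y) = proj x + proj y.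
Proof. exact: raddfD. Qed.

Definition quot_scale (a : F) (q : Q) : Q := proj (a *: repr q).

Lemma projZ (a : F) (x : L) : proj (a *: x) = quot_scale a (proj x).
Proof.
apply/esym/quot_eqP.
by rewrite -scalerBr memvZ ?quot_reprB.
Qed.

Fact quot_scaleA a b (q : Q) :
  quot_scale a (quot_scale b q) = quot_scale (a * b) q.
Proof. by elim/quot_ind: q => x; rewrite -!projZ scalerA. Qed.

Fact quot_scale1 : left_id 1 quot_scale.
Proof. by elim/quot_ind=> x; rewrite -projZ scale1r. Qed.

Fact quot_scaleDr : right_distributive quot_scale +%R.
Proof.
move=> a; elim/quot_ind=> x; elim/quot_ind=> y.
by rewrite -projD -!projZ -projD scalerDr.
Qed.

Fact quot_scaleDl (q : Q) : {morph quot_scale^~ q : a b / a + b}.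
Proof. by move=> a b; elim/quot_ind: q => x; rewrite -!projZ -projD scalerDl. Qed.

HB.instance Definition _ := GRing.Zmodule_isLmodule.Build F Q
  quot_scaleA quot_scale1 quot_scaleDr quot_scaleDl.

Fact proj_is_linear : linear proj.
Proof. by move=> a x y; rewrite projD projZ. Qed.

HB.instance Definition _ :=
  GRing.isLinear.Build F L Q *:%R proj proj_is_linear.

(* Coordinates on L / I: those of the component along a complement of I. *)
Fact quot_vect_axiom : Vector.axiom (\dim (ideal_space I)^C%VS) Q.
Proof.
pose C := (ideal_space I)^C%VS; pose e := vbasis C.
have CI0 : (C :&: I)%VS = 0%VS by rewrite capvC capv_compl.
have /freeP e_free : free e by apply: (basis_free (vbasisP C)).
pose g (r : 'rV[F]_(\dim C)) : Q := proj (\sum_i r 0 i *: e`_i).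
have g_lin : linear g.
  move=> a r s; rewrite /g -linearP scaler_sumr -big_split /=; congr (proj _).
  by apply: eq_bigr => i _; rewrite !mxE scalerDl scalerA.
have g_inj : injective g.
  move=> r s /quot_eqP; rewrite -sumrB => rsI; apply/rowP => i.
  have rsC : \sum_i (r 0 i *: e`_i - s 0 i *: e`_i) \in C.
    apply: memv_suml => j _; apply: memvB; apply/memvZ/vbasis_mem/mem_nth;
    by rewrite size_tuple.
  have: \sum_i (r 0 i *: e`_i - s 0 i *: e`_i) \in (C :&: I)%VS.
    by rewrite memv_cap rsC.
  rewrite CI0 memv0 => /eqP rs0; apply/eqP; rewrite -subr_eq0; apply/eqP.
  apply: (e_free (fun i => r 0 i - s 0 i)).
  by rewrite -[RHS]rs0; apply: eq_bigr => j _; rewrite scalerBl.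
have g_surj q : exists r, g r == q.
  have /memv_addP[u uI [v vC quv]] : repr q \in (I + C)%VS.
    by rewrite addv_complf memvf.
  exists (\row_i coord e i v); rewrite /g -[q]reprK -/(proj _) quv.
  under eq_bigr do rewrite mxE.
  rewrite -(coord_vbasis vC); apply/eqP/quot_eqP.
  by rewrite opprD addrA addrAC subrr sub0r memvN.
pose f q := xchoose (g_surj q).
have fK : cancel f g by move=> q; apply/eqP; apply: (xchooseP (g_surj q)).
have gK : cancel g f by move=> r; apply: g_inj; rewrite fK.
exists f; last by exists g.
by move=> a p q; apply: g_inj; rewrite g_lin !fK.
Qed.

HB.instance Definition _ := Lmodule_hasFinDim.Build F Q quot_vect_axiom.

Definition quot_bracket (p q : Q) : Q := proj (bracket (repr p) (repr q)).

Lemma proj_bracket x y :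
  proj (bracket x y) = quot_bracket (proj x) (proj y).
Proof.
apply/esym/quot_eqP; set x' := repr _; set y' := repr _.
have -> : bracket x' y' - bracket x y =
    bracket (x' - x) y' + bracket x (y' - y).
  by rewrite linearBl linearBr addrA subrK.
apply: memvD.
- exact: (idealP (i := I) y' (quot_reprB x)).2.
- exact: (idealP (i := I) x (quot_reprB y)).1.
Qed.

Fact quot_bracket_bilinear : bilinear_for *:%R *:%R quot_bracket.
Proof.
split; elim/quot_ind=> z a; elim/quot_ind=> x; elim/quot_ind=> y.
- by rewrite -linearP -!proj_bracket linearPl linearP.
- by rewrite -linearP -!proj_bracket linearPr linearP.
Qed.

Fact quot_bracket_leibniz p q r :
  quot_bracket p (quot_bracket q r) =
  quot_bracket (quot_bracket p q) r - quot_bracket (quot_bracket p r) q.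
Proof.
elim/quot_ind: p => x; elim/quot_ind: q => y; elim/quot_ind: r => z.
by rewrite -!proj_bracket -linearB bracket_leibniz.
Qed.

HB.instance Definition _ := Vector_isLeibniz.Build F Q
  quot_bracket_bilinear quot_bracket_leibniz.

End Quotient.

Section LieQuotient.
Variables (F : fieldType) (L : leibnizAlgType F).

Fact quot_squares_bracketxx (q : quot_alg (squares_ideal L)) :
  bracket q q = 0.
Proof.
elim/quot_ind: q => x.
rewrite -[LHS]proj_bracket -[RHS](linear0 (@quot_proj F L _)); apply/quot_eqP.
by rewrite subr0; apply: sub_ideal_gen; exists x.
Qed.

HB.instance Definition _ :=
  Leibniz_isLie.Build F (quot_alg (squares_ideal L)) quot_squares_bracketxx.

Definition lie_quot : lieAlgType F := quot_alg (squares_ideal L).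

Definition natural_hom : 'Hom(L, lie_quot) :=
  linfun (@quot_proj F L (squares_ideal L)).

Lemma natural_homE x : natural_hom x = quot_proj (squares_ideal L) x.
Proof. by rewrite lfunE. Qed.

Lemma natural_hom_bracket x y :
  natural_hom (bracket x y) = bracket (natural_hom x) (natural_hom y).
Proof. by rewrite !natural_homE; apply: proj_bracket. Qed.

Lemma lker_natural_hom : lker natural_hom = squares_ideal L.
Proof.
apply/vspaceP => x; rewrite memv_ker natural_homE.
by rewrite -[0 in LHS](linear0 (@quot_proj F L _)) quot_eqE subr0.
Qed.

Lemma limg_natural_hom : limg natural_hom = fullv.
Proof.
apply/vspaceP => q; rewrite memvf; elim/quot_ind: q => x; apply/memv_imgP.
by exists x; rewrite ?memvf ?natural_homE.
Qed.

End LieQuotient.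

Arguments natural_hom {F} L.

(* Main.v *)
Require Import Defs.
From mathcomp Require Import all_boot all_order all_algebra.

(** Write N = H + I.  The point is that [x, H] <= N forces x \in N.  The right
multiplications R_h (h \in H) act on L and preserve H, and the claim is proved
for x in any R_H-stable W >= H by induction on dim W.  If some R_h is not
nilpotent on W, Fitting's lemma for R_h on N :&: W replaces x by x - y with
y \in N and x - y in the generalized kernel of R_h, which meets W in a smaller
R_H-stable subspace, still containing H because H is nilpotent.  If every R_h
is nilpotent on W, an Engel argument shows that W = H, since H is its own left
normalizer. *)

Set Implicit Arguments.
Unset Strict Implicit.
Unset Printing Implicit Defensive.

Import GRing.Theory.
Local Open Scope ring_scope.

Section Fitting.
Variables (F : fieldType) (V : vectType F).
Implicit Types (f : 'End(V)) (U : {vspace V}).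

Fixpoint lfun_iter f n : 'End(V) :=
  if n is m.+1 then (f \o lfun_iter f m)%VF else \1%VF.

Lemma lfun_iterE f n x : lfun_iter f n x = iter n f x.
Proof. by elim: n => [|n IH] /=; rewrite ?id_lfunE // comp_lfunE IH. Qed.

Lemma iter_lfun0 f n : iter n f 0 = 0.
Proof. by rewrite -lfun_iterE linear0. Qed.

Lemma lker_lfun_iter_leq f m n :
  (m <= n)%N -> (lker (lfun_iter f m) <= lker (lfun_iter f n))%VS.
Proof.
move=> le_mn; apply/subvP => x; rewrite !memv_ker !lfun_iterE => /eqP fx0.
by rewrite -(subnK le_mn) iterD fx0 iter_lfun0.
Qed.

(** The kernels grow with the exponent, so one of maximal dimension contains all the others. *)
Lemma lker_lfun_iter_stable f :
  exists M, forall n, (lker (lfun_iter f n) <= lker (lfun_iter f M))%VS.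
Proof.
pose P d := `[< exists n, \dim (lker (lfun_iter f n)) = d >].
have exP : exists d, P d by exists (\dim (lker (lfun_iter f 0))); apply/asboolP; exists 0%N.
have leP d : P d -> (d <= \dim {:V})%N.
  by move=> /asboolP[n <-]; apply/dimvS/subvf.
case: (ex_maxnP exP leP) => d /asboolP[M dM] max_d; exists M => n.
have [le_nM|/ltnW le_Mn] := leqP n M; first exact: lker_lfun_iter_leq.
have /eqP -> // : lker (lfun_iter f M) == lker (lfun_iter f n).
rewrite eqEdim lker_lfun_iter_leq //= dM; apply: max_d.
by apply/asboolP; exists n.
Qed.

(** The images of [U] under powers of [f] decrease and become constant at some [m]. Then [f^m (f w)]
    equals [f^(m+1) y] with [y] in [U], and [f^(m+1)] kills [w - y]. *)
Lemma fitting_split f U w :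
    (f @: U <= U)%VS -> f w \in U ->
  exists2 y, y \in U & exists n, w - y \in lker (lfun_iter f n).
Proof.
move=> fU fwU.
pose P d := `[< exists n, \dim (lfun_iter f n @: U) = d >].
have exP : exists d, P d by exists (\dim (lfun_iter f 0 @: U)); apply/asboolP; exists 0%N.
case: (ex_minnP exP) => d /asboolP[m dm] min_d.
have limgS : (lfun_iter f m.+1 @: U <= lfun_iter f m @: U)%VS.
  apply/subvP => _ /memv_imgP[u uU ->].
  rewrite lfun_iterE iterSr -lfun_iterE memv_img //.
  by apply: (subvP fU); apply: memv_img.
have eqm : (lfun_iter f m.+1 @: U = lfun_iter f m @: U)%VS.
  apply/eqP; rewrite eqEdim limgS dm; apply: min_d.
  by apply/asboolP; exists m.+1.
have: lfun_iter f m (f w) \in (lfun_iter f m.+1 @: U)%VS by rewrite eqm memv_img.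
case/memv_imgP => y yU fwy; exists y => //; exists m.+1.
by rewrite memv_ker linearB /= -fwy !(lfun_iterE, comp_lfunE) -iterSr subrr.
Qed.

End Fitting.

Section NilpotentSubalgebra.
Variables (F : fieldType) (L : leibnizAlgType F).
Implicit Types (H N W : {vspace L}) (h k w x y : L).

Definition rmul h : 'End(L) := linfun (applyr (@bracket F L) h).

Lemma rmulE h x : rmul h x = bracket x h.
Proof. by rewrite lfunE. Qed.

Lemma bracketxr h k w : bracket w (bracket h k) = - bracket w (bracket k h).
Proof. by rewrite !bracket_leibniz opprB. Qed.

(** The Leibniz identity read as: [rmul h] is a derivation. *)
Lemma bracket_rmul w k h :
  bracket (bracket w k) h = bracket w (bracket k h) + bracket (bracket w h) k.
Proof. by rewrite (bracket_leibniz w k h) subrK. Qed.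

Section Fixed.
Variable H : {vspace L}.
Hypotheses (subH : is_subalgebra H) (nilH : is_nilpotent H).

Lemma lower_central_sub n : (lower_central H n <= H)%VS.
Proof.
elim: n => //= n IH; apply/bracketvP => x y xH yH.
exact: (bracketvP _ _ _ subH) (subvP IH _ xH) yH.
Qed.

(** By the derivation rule each application of [rmul h] falls on [w], which it kills after [n]
    steps, or on [k], which it moves down the lower central series of [H]. *)
Lemma genker_rmul_stable h k w n : h \in H -> k \in H ->
    w \in lker (lfun_iter (rmul h) n) ->
  exists m, bracket w k \in lker (lfun_iter (rmul h) m).
Proof.
move=> hH kH; case: nilH => s Hs0.
(* [j] bounds the steps that [k], now at level [i], can still descend before vanishing. *)
suff main j : forall i n w k, (s <= i + j)%N -> k \in lower_central H i ->
    iter n (rmul h) w = 0 -> iter (n + j) (rmul h) (bracket w k) = 0.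
  rewrite memv_ker lfun_iterE => /eqP w0; exists (n + s)%N.
  by rewrite memv_ker lfun_iterE (main _ 0%N).
elim: j => [|j IHj] i {kH} {}n {}w {}k; last first.
  elim: n w => [w _ _ /= ->|n IHn w le_s kHi w0].
    by rewrite linear0l iter_lfun0 linear0.
  rewrite addSn iterSr rmulE bracket_rmul -lfun_iterE linearD /= !lfun_iterE.
  rewrite IHn ?addr0 //; last by rewrite -rmulE -iterSr.
  (* The exponent [n + j.+1] is read as [n.+1 + j]: [w] is unchanged and [[k, h]] lies one level
     lower. *)
  rewrite -addSnnS.
  by apply: (IHj i.+1 n.+1); rewrite ?addSnnS //; apply: memv_bracket.
rewrite addn0 => le_si kHi _; suff -> : k = 0 by rewrite linear0r iter_lfun0.
have: lower_central H i = 0%VS.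
  rewrite -(subnK le_si); elim: (i - s)%N => //= p ->.
  apply/eqP; rewrite -subv0; apply/bracketvP => x y /[!memv0] /eqP -> _.
  by rewrite linear0l.
by move=> Hi0; move: kHi; rewrite Hi0 memv0 => /eqP.
Qed.

(** Iterating [rmul h] from a point of [H] descends the lower central series. *)
Lemma sub_genker_rmul h : h \in H ->
  exists n, (H <= lker (lfun_iter (rmul h) n))%VS.
Proof.
move=> hH; case: nilH => s Hs0; exists s; apply/subvP => x xH.
rewrite memv_ker lfun_iterE -memv0 -Hs0.
elim: (s) => //= n IH; rewrite rmulE; exact: memv_bracket.
Qed.

(** Take [h] outside [K] in the last term of the lower central series not contained in [K];
    bracketing with [H] lands in the next term. *)
Lemma nilpotent_step K : (K <= H)%VS -> K != H ->
  exists2 h, h \in H & h \notin K /\ forall k, k \in H -> bracket h k \in K.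
Proof.
move=> sKH neKH; case: nilH => s Hs0.
have exP : exists n, (lower_central H n <= K)%VS by exists s; rewrite Hs0 sub0v.
case: (ex_minnP exP) => -[|n] /= sHK minn.
  by move: neKH; rewrite eqEsubv sKH sHK.
have /subvPn[h hHn hK] : ~~ (lower_central H n <= K)%VS.
  by apply/negP => /minn; rewrite ltnn.
exists h; first exact: (subvP (lower_central_sub n)).
by split=> // k kH; apply: (bracketvP _ _ _ sHK).
Qed.

(** A subspace [K] grows from 0 to [H] one vector at a time, while a vector [w] of [W] outside [H]
    with [[w, K]] inside [H] is updated. *)
Lemma engel_normalizer W : (bracketv W H <= W)%VS ->
    (forall h, h \in H -> exists n, (W <= lker (lfun_iter (rmul h) n))%VS) ->
    ~~ (W <= H)%VS ->
  exists2 w, w \notin H & forall h, h \in H -> bracket w h \in H.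
Proof.
move=> /bracketvP stW nilW nWH.
suff main d K : (\dim H - \dim K <= d)%N -> (K <= H)%VS ->
    (forall k h, k \in K -> h \in H -> bracket k h \in K) ->
    (exists2 w, w \in W & w \notin H /\ forall k, k \in K -> bracket w k \in H) ->
    exists2 w, w \notin H & forall h, h \in H -> bracket w h \in H.
  case/subvPn: nWH => w wW wH.
  apply: (main _ 0%VS (leqnn _)); rewrite ?sub0v //.
    by move=> k h /[!memv0] /eqP -> _; rewrite linear0l.
  by exists w => //; split=> // k /[!memv0] /eqP ->; rewrite linear0r mem0v.
elim: d K => [|d IHd] K le_d sKH stK [w wW [wH wK]];
  have [eqKH|neKH] := eqVneq K H;
  try by exists w => // h hH; apply: wK; rewrite eqKH.
  by case/eqP: neKH; apply/eqP; rewrite eqEdim sKH -subn_eq0 -leqn0.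
have [h hH [hK hHK]] := nilpotent_step sKH neKH.
have sK'H : (K + <[h]> <= H)%VS by rewrite subv_add sKH -memvE.
apply: (IHd (K + <[h]>)%VS _ sK'H).
- have ltK : (\dim K < \dim (K + <[h]>))%N.
    rewrite ltn_neqAle dimvS ?addvSl // andbT; apply: contra hK => eqd.
    have /eqP-> : K == (K + <[h]>)%VS by rewrite eqEdim addvSl /= (eqP eqd).
    by rewrite memvE addvSr.
  rewrite -ltnS (leq_trans _ le_d) // ltn_sub2l //.
  exact: leq_trans ltK (dimvS sK'H).
- move=> _ k /memv_addP[u uK [_ /vlineP[a ->] ->]] kH.
  rewrite linearDl linearZl_LR /=; apply: (subvP (addvSl _ _)).
  by apply: memvD; [exact: stK | exact/memvZ/hHK].
(* Inductively, [[[w, h], k] = -[w, [k, h]] + [[w, k], h]], and both terms lie in [H]. *)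
have iterP n : iter n (rmul h) w \in W /\
    forall k, k \in K -> bracket (iter n (rmul h) w) k \in H.
  elim: n => //= n [itW itK]; rewrite rmulE; split=> [|k kK]; first exact: stW.
  rewrite bracket_rmul bracketxr memvD ?memvN ?itK ?stK //.
  by apply: (bracketvP _ _ _ subH); rewrite ?itK.
have exP : exists n, iter n (rmul h) w \in H.
  have [n /subvP/(_ w wW)] := nilW h hH.
  by rewrite memv_ker lfun_iterE => /eqP w0; exists n; rewrite w0 mem0v.
(* The new [w] is the last iterate before the first entry into [H], so its bracket with [h] is in
   [H]. *)
case: (ex_minnP exP) => -[|n] /= itH minn; first by rewrite itH in wH.
have [itW itK] := iterP n; exists (iter n (rmul h) w) => //; split.
  by apply/negP => /minn; rewrite ltnn.
move=> _ /memv_addP[u uK [_ /vlineP[a ->] ->]].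
rewrite linearDr linearZr_LR; apply: memvD; first exact: itK.
by rewrite rmulE in itH; apply: memvZ.
Qed.

(** For [N] the preimage of the image of [H] and [W] the whole algebra, this is the normalizer
    condition in the quotient. *)
Lemma self_normalizing_mod N W w :
    (forall x, (forall h, h \in H -> bracket x h \in H) -> x \in H) ->
    (H <= N)%VS -> (bracketv N H <= N)%VS ->
    (H <= W)%VS -> (bracketv W H <= W)%VS ->
    w \in W -> (forall h, h \in H -> bracket w h \in N) ->
  w \in N.
Proof.
move=> normH sHN /bracketvP stN.
elim/ltn_ind: {W}(\dim W) {-2}W (erefl (\dim W)) w => d IHd W dW w sHW stW wW wN.
have [nilW|] := pselect
    (forall h, h \in H -> exists n, (W <= lker (lfun_iter (rmul h) n))%VS).
  have [sWH|nsWH] := boolP (W <= H)%VS.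
    by apply/(subvP sHN)/(subvP sWH).
  have [x xH normx] := engel_normalizer stW nilW nsWH.
  by case/negP: xH; apply: normH.
move/bracketvP in stW.
move/existsNP => [h /not_implyP[hH /forallNP nnil]].
have [M kerM] := lker_lfun_iter_stable (rmul h).
pose W0 := (W :&: lker (lfun_iter (rmul h) M))%VS.
(* Equality would make [rmul h] nilpotent on [W], against the choice of [h]. *)
have ltW0 : (\dim W0 < d)%N.
  rewrite -dW ltn_neqAle dimvS ?capvSl // andbT.
  apply/negP => /eqP eqd; apply: (nnil M).
  have /eqP <- : W0 == W by rewrite eqEdim capvSl /= eqd.
  exact: capvSr.
(* Intersecting [N] with [W] keeps [w - y] inside [W]. *)
have [||y] := @fitting_split _ _ (rmul h) (N :&: W)%VS w.
- apply/subvP => _ /memv_imgP[u + ->]; rewrite !memv_cap rmulE => /andP[uN uW].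
  by rewrite stN ?stW.
- by rewrite memv_cap rmulE wN ?stW.
rewrite memv_cap => /andP[yN yW] [n wyn].
rewrite -(subrK y w) memvD //; apply: (IHd _ ltW0 W0 erefl).
- have [p Hp] := sub_genker_rmul hH.
  by rewrite subv_cap sHW (subv_trans Hp).
- apply/bracketvP => x k; rewrite !memv_cap => /andP[xW xM] kH.
  have [p xkp] := genker_rmul_stable hH kH xM.
  by rewrite stW //= (subvP (kerM p)).
- by rewrite memv_cap memvB //= (subvP (kerM n)).
- by move=> k kH; rewrite linearBl memvB ?wN ?stN.
Qed.

End Fixed.
End NilpotentSubalgebra.

Lemma cartan_natural_hom (F : fieldType) (L : leibnizAlgType F) (H : {vspace L}) :
  is_cartan H -> is_cartan (natural_hom L @: H)%VS.
Proof.
case=> subH nilH normH; set phi := natural_hom L.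
have subphiH : is_subalgebra (phi @: H)%VS.
  apply/bracketvP => _ _ /memv_imgP[x xH ->] /memv_imgP[y yH ->].
  by rewrite -natural_hom_bracket memv_img //; apply: (bracketvP _ _ _ subH).
split=> //.
- case: nilH => s Hs0; exists s.
  suff lc n : (lower_central (phi @: H) n <= phi @: lower_central H n)%VS.
    by apply/eqP; rewrite -subv0 (subv_trans (lc s)) // Hs0 limg0.
  elim: n => //= n /subvP IH; apply/bracketvP => _ _ /IH/memv_imgP[x xH ->] /memv_imgP[y yH ->].
  rewrite -natural_hom_bracket memv_img //.
  exact: memv_bracket.
apply/seteqP; split=> q /=; first by move=> qH h hH; apply: (bracketvP _ _ _ subphiH).
have /memv_imgP[x _ ->] : q \in limg phi by rewrite limg_natural_hom memvf.
(* Membership in the image is pulled back to [L], since [phi] has kernel [squares_ideal L]. *)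
have memHI y : (phi y \in (phi @: H)%VS) = (y \in (H + squares_ideal L)%VS).
  apply/idP/idP => [/memv_imgP[h hH /eqP]|/memv_addP[h hH [z zI ->]]].
    rewrite -subr_eq0 -linearB -memv_ker lker_natural_hom => yhI.
    by rewrite -(subrK h y) addrC memv_add.
  move: zI; rewrite -lker_natural_hom memv_ker => /eqP phiz.
  by rewrite linearD /= phiz addr0 memv_img.
move=> xH; rewrite memHI.
apply: (@self_normalizing_mod _ _ H subH nilH _ fullv).
- by move=> y yH; have : left_normalizer H y by []; rewrite -normH.
- exact: addvSl.
- apply/bracketvP => _ h /memv_addP[u uH [z zI ->]] hH.
  rewrite linearDl memv_add ?(bracketvP _ _ _ subH) //.
  exact: (idealP (i := squares_ideal L) h zI).2.
- exact: subvf.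
- exact: subvf.
- exact: memvf.
by move=> h hH; rewrite -memHI natural_hom_bracket; apply/xH/memv_img.
Qed.

Theorem theorem3p2 (R : realType) (L : leibnizAlgType R[i]) (H : {vspace L}) :
  is_cartan H -> is_cartan (natural_hom L @: H)%VS.
Proof. exact: cartan_natural_hom. Qed.
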